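(* Let $p\ge 5$ be a prime, $K$ an imaginary quadratic field in which $p$ is unramified, and $f\in S_2(\Gamma_0(N))$ a newform with $p\nmid N$, where $N=N^+N^-$ with $N^-$ square-free and a product of an odd number of primes. Assume $f$ is ordinary at $p$, i.e. $a_p(f)\in\mathcal{O}^\times$, let $\alpha$ be the unit root of $X^2-a_p(f)X+p$, and let $L_p(f/K_\infty)\in\Lambda$ be the anticyclotomic $p$-adic $L$-function described in the context. Suppose $L_p(f/K_\infty)\neq 0$ and $\mu(L_p(f/K_\infty))=0$. Then for all sufficiently large $n$: (1) $\mu(\mathcal{L}_{f,n})=0$; (2) $2\lambda(\mathcal{L}_{f,n})=\lambda(L_p(f/K_\infty))$.
   Context: Setting. $K_\infty$ is the anticyclotomic $\mathbb{Z}_p$-extension of $K$, $K_n\subset K_\infty$ the subextension with $[K_n:K]=p^n$, $G_n=\mathrm{Gal}(K_n/K)$, $\Gamma=\mathrm{Gal}(K_\infty/K)$ with topological generator $\gamma$. The primes dividing $N^+$ split in $K$ and those dividing $N^-$ are inert in $K$. $\mathcal{O}$ is the ring of integers of the completion, at a fixed prime above $p$, of the field generated by the Fourier coefficients of $f$; $\varpi$ is a uniformizer and $\mathbb{F}$ the residue field. $\Lambda=\varprojlim_n\mathcal{O}[G_n]\cong\mathcal{O}[[T]]$ via $\gamma\mapsto 1+T$. Iwasawa invariants. For $P=\sum_j b_jT^j\in\mathcal{O}[[T]]$: $\mu(P)=\min_j\mathrm{ord}_p(b_j)$, $\lambda(P)=\min\{j:\mathrm{ord}_p(b_j)=\mu(P)\}$.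 For $\theta=\sum_{\sigma\in G_n}c_\sigma\sigma\in\mathcal{O}[G_n]$: $\mu(\theta)=\min_\sigma\mathrm{ord}_p(c_\sigma)$; putting $\theta'$ equal to $\theta$ divided by the power of the uniformizer realizing $\mu(\theta)$, and $\overline{\theta'}$ its (nonzero) image in $\mathbb{F}[G_n]$, $\lambda(\theta)=\max\{j:\overline{\theta'}\in I_n^j\}$ where $I_n$ is the augmentation ideal of $\mathbb{F}[G_n]$. Bertolini–Darmon theta elements. Let $B$ be the definite quaternion algebra of discriminant $N^-$, $R$ an Eichler $\mathbb{Z}[1/p]$-order of level $N^+$ in $B$, $\mathcal{T}$ the Bruhat–Tits tree of $(B\otimes\mathbb{Q}_p)^\times/\mathbb{Q}_p^\times\cong\mathrm{PGL}_2(\mathbb{Q}_p)$, and $\mathbf{\Gamma}=R^\times/\mathbb{Z}[1/p]^\times$. By the Jacquet–Langlands correspondence there is an $\mathcal{O}$-valued $\mathbf{\Gamma}$-invariant function $h$ on oriented edges of $\mathcal{T}$, not divisible by $\varpi$, with the same Hecke eigenvalues as $f$ at primes $\ell\nmid N$. A fixed embedding $\Psi:K\to B$ with $\Psi(K)\cap R=\Psi(\mathcal{O}_K[1/p])$ gives an action $\sigma\star x$ of $K_p^\times/\mathbb{Q}_p^\times$ on $\mathcal{T}$; with the standard filtration $U_n$ and vertices $v_n$ of Darmon–Iovita and $\widetilde G_n$ the corresponding quotient, $\widetilde{\mathcal{L}}_{f,n}=\sum_{\sigma\in\widetilde G_n}h(\sigma\star v_n)\sigma^{-1}$, and $\mathcal{L}_{f,n}\in\mathcal{O}[G_n]$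 is its image. For the projection $\pi_n^{n+1}:\mathcal{O}[G_{n+1}]\to\mathcal{O}[G_n]$ and the norm map $\xi_{n-1}:\mathcal{O}[G_{n-1}]\to\mathcal{O}[G_n]$ (sending $\sigma$ to the sum of its lifts), they satisfy $\pi_n^{n+1}(\mathcal{L}_{f,n+1})=a_p(f)\mathcal{L}_{f,n}-\xi_{n-1}(\mathcal{L}_{f,n-1})$. $p$-adic $L$-function. $\mathcal{L}_{f_\alpha,n}=\alpha^{-n}\big(\mathcal{L}_{f,n}-\alpha^{-1}\xi_{n-1}(\mathcal{L}_{f,n-1})\big)$; these are compatible under the projections. $L_p(f/K_\infty)=\varprojlim_n\mathcal{L}_{f_\alpha,n}\cdot\iota(\mathcal{L}_{f_\alpha,n})\in\Lambda$, where $\iota$ is the involution induced by $\sigma\mapsto\sigma^{-1}$. *)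

(* Defs.v *)
From HB Require Import structures.
From mathcomp Require Import all_boot all_order all_algebra all_fingroup all_field.
From mathcomp Require Import complex.
From mathcomp Require Import all_classical all_reals all_analysis.

Set Implicit Arguments.
Unset Strict Implicit.
Unset Printing Implicit Defensive.

Import Order.TTheory GRing.Theory Num.Theory.
Import numFieldNormedType.Exports.

Local Open Scope classical_set_scope.
Local Open Scope ring_scope.

Definition lin_span (F : nzRingType) (V : lmodType F) (S : set F) (T : set V) :
    set V :=
  [set x | exists (k : nat) (c : 'I_k -> F) (y : 'I_k -> V),
     (forall i, S (c i) /\ T (y i)) /\ x = \sum_(i < k) c i *: y i].

Definition has_index (V : zmodType) (A P : set V) (k : nat) : Prop :=
  exists t : 'I_k -> V,
    (forall i, A (t i)) /\ (forall x, A x -> exists! i, P (x - t i)).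

Definition is_ideal (X : comNzRingType) (A P : set X) : Prop :=
  [/\ P `<=` A, P 0, (forall x y, P x -> P y -> P (x - y))
    & (forall a x, A a -> P x -> P (a * x))].

Definition prime_ideal (X : comNzRingType) (A P : set X) : Prop :=
  [/\ is_ideal A P, ~ P 1
    & forall x y, A x -> A y -> P (x * y) -> P x \/ P y].

Definition ideal_mul (X : comNzRingType) (P Q : set X) : set X :=
  [set x | exists (k : nat) (a b : 'I_k -> X),
     (forall i, P (a i) /\ Q (b i)) /\ x = \sum_(i < k) a i * b i].

Definition principal (X : comNzRingType) (A : set X) (y : X) : set X :=
  [set y * a | a in A].

Definition algebraic_integers (X : nzRingType) : set X :=
  [set x | integralOver (intr : int -> X) x].

Definition p_integers (p : nat) (X : nzRingType) : set X :=
  [set x | exists k, algebraic_integers (p%:R ^+ k * x)].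

Definition imaginary_quadratic (K : fieldExtType rat)
    (iK : {rmorphism K -> algC}) : Prop :=
  \dim {: K} = 2%N /\ exists x, iK x \isn't Num.real.

Definition inert (K : fieldExtType rat) (q : nat) : Prop :=
  prime_ideal (@algebraic_integers K) (principal (@algebraic_integers K) q%:R).

Definition splits (K : fieldExtType rat) (q : nat) : Prop :=
  exists P1 P2 : set K,
    [/\ prime_ideal (@algebraic_integers K) P1, P1 q%:R,
        prime_ideal (@algebraic_integers K) P2, P2 q%:R & P1 <> P2].

Definition unramified (K : fieldExtType rat) (q : nat) : Prop :=
  forall P : set K, prime_ideal (@algebraic_integers K) P ->
    P q%:R -> ~ ideal_mul P P q%:R.

Definition squarefree (n : nat) : Prop :=
  (0 < n)%N /\ forall q, prime q -> ~~ (q ^ 2 %| n)%N.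

(* The library puts no topology on [R[i]] itself; viewed as a [numFieldType]
   it gets the topology of its norm. *)
Definition cplx (R : realType) : numFieldType := R[i].

Section Newforms.
Context (R : realType).
Local Notation C := (cplx R).
Local Notation Im := (@complex.Im R).

Definition ofR (x : R) : C := (x%:C)%C.
Definition upper (z : C) : Prop := 0 < Im z.

(* e^(2 pi i z) *)
Definition nome (z : C) : C :=
  ofR (expR (- (2 * pi * Im z))) *
  ((cos (2 * pi * complex.Re z)) +i* (sin (2 * pi * complex.Re z)))%C.

Definition autj (g : 'M[int]_2) (z : C) : C :=
  (g 1 0)%:~R * z + (g 1 1)%:~R.
Definition moebius (g : 'M[int]_2) (z : C) : C :=
  ((g 0 0)%:~R * z + (g 0 1)%:~R) / autj g z.
Definition slash2 (f : C -> C) (g : 'M[int]_2) (z : C) : C :=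
  autj g z ^- 2 * f (moebius g z).

Definition Gamma0 (N : nat) : set 'M[int]_2 :=
  [set g : 'M[int]_2 | \det g = 1 /\ (N %| g 1%R 0%R)%Z].

Definition cusp_form2 (N : nat) (f : C -> C) : Prop :=
  [/\ forall z, upper z -> derivable f z 1,
      forall g, Gamma0 N g -> forall z, upper z -> slash2 f g z = f z
    & forall g : 'M[int]_2, \det g = 1 -> forall e : R, 0 < e ->
        exists Y : R, forall z, upper z -> Y < Im z -> `|slash2 f g z| < ofR e].

Definition fourier_coefficients (f : C -> C) (a : nat -> C) : Prop :=
  forall z, upper z ->
    (fun n => \sum_(k < n) a k * nome z ^+ k) @ \oo --> f z.

(* T_l for l not dividing N, U_l for l dividing N *)
Definition hecke2 (N l : nat) (f : C -> C) (z : C) : C :=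
  l%:R^-1 * \sum_(b < l) f ((z + b%:R) / l%:R) +
  (if (l %| N)%N then 0 else l%:R * f (l%:R * z)).

(* representatives of Gamma0(N) \ SL_2(Z) *)
Definition coset_reps (N : nat) (s : seq 'M[int]_2) : Prop :=
  (forall g, g \in s -> \det g = 1) /\
  forall g : 'M[int]_2, \det g = 1 ->
    exists! i : 'I_(size s),
      exists2 d, Gamma0 N d & g = d *m nth 0 s i.

Definition SL2Z_domain : set (R * R) :=
  [set w | [/\ `|w.1| <= 1 / 2, 1 <= w.1 ^+ 2 + w.2 ^+ 2 & 0 < w.2]].

(* Integral of f * conj g * y^2 dx dy / y^2 over Gamma0(N) \ H, the domain being
   cut into the translates of the domain of SL_2(Z). *)
Definition petersson2 (N : nat) (f g : C -> C) : C :=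
  let mu := (lebesgue_measure \x lebesgue_measure)%E in
  let F (c : 'M[int]_2) (w : R * R) : C :=
    slash2 f c (w.1 +i* w.2)%C * ((slash2 g c (w.1 +i* w.2)%C)^*)%C in
  \sum_(c <- xget [::] [set s | coset_reps N s])
     ((\int[mu]_(w in SL2Z_domain) complex.Re (F c w)) +i*
      (\int[mu]_(w in SL2Z_domain) Im (F c w)))%C.

(* Normalised Hecke eigenform, orthogonal to the forms g(d z) with g of level M,
   M d dividing N and M < N. *)
Definition newform2 (N : nat) (f : C -> C) (a : nat -> C) : Prop :=
  [/\ cusp_form2 N f, fourier_coefficients f a, a 1%N = 1,
      (forall l, prime l -> exists c : C,
         forall z, upper z -> hecke2 N l f z = c * f z)
    & forall (M d : nat) (g : C -> C), (M < N)%N -> (M * d %| N)%N ->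
        cusp_form2 M g -> petersson2 N f (fun z => g (d%:R * z)) = 0].

End Newforms.

Definition eq_mod (O : comNzRingType) (w : O) (k : nat) (x y : O) : Prop :=
  exists z, x - y = w ^+ k * z.

Definition complete_dvr (O : idomainType) (w : O) : Prop :=
  [/\ w != 0, w \isn't a GRing.unit,
      (forall x, x != 0 -> exists (k : nat) (u : O),
         u \is a GRing.unit /\ x = u * w ^+ k)
    & forall u : nat -> O, (forall k, eq_mod w k (u k.+1) (u k)) ->
        exists l, forall k, eq_mod w k l (u k)].

(* Zp is the ring of p-adic integers; Q_p is then {fraction Zp}. *)
Definition padic_integers (p : nat) (Zp : idomainType) : Prop :=
  complete_dvr (p%:R : Zp) /\
  forall (x : Zp) (k : nat), exists m : int, eq_mod (p%:R : Zp) k x m%:~R.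

Definition integral_in (Zp : idomainType) : set {fraction Zp} :=
  [set x | exists z : Zp, x = tofrac z].

(* O is the ring of integers of the completion of E at a prime above p. *)
Definition completed_integers (p : nat) (E : fieldType) (O : idomainType)
    (w : O) (iO : {rmorphism E -> {fraction O}}) : Prop :=
  [/\ complete_dvr w, eq_mod w 1 (p%:R) 0
    & forall (x : O) (k : nat), exists (e : E) (y : O),
        iO e = tofrac y /\ eq_mod w k x y].

Definition residue_field (O : idomainType) (w : O) (F : fieldType)
    (red : {rmorphism O -> F}) : Prop :=
  (forall y, exists x, red x = y) /\
  (forall x, red x = 0 <-> eq_mod w 1 x 0).

Section GroupRing.
Context (A : comNzRingType).
Implicit Types G H : finGroupType.

Definition gmul G (x y : {ffun G -> A}) : {ffun G -> A} :=
  [ffun g => \sum_(k : G) x k * y (k^-1 * g)%g].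
Definition gdelta G (g : G) : {ffun G -> A} := [ffun k => (k == g)%:R].
Definition gpow G (x : {ffun G -> A}) (j : nat) : {ffun G -> A} :=
  iter j (gmul x) (gdelta 1%g).
Definition giota G (x : {ffun G -> A}) : {ffun G -> A} := [ffun g => x g^-1%g].
Definition gscale G (c : A) (x : {ffun G -> A}) : {ffun G -> A} :=
  [ffun g => c * x g].
Definition gpush G H (f : G -> H) (x : {ffun G -> A}) : {ffun H -> A} :=
  [ffun h => \sum_(g : G | f g == h) x g].
(* each h is sent to the sum of its lifts under f *)
Definition gnorm G H (f : G -> H) (x : {ffun H -> A}) : {ffun G -> A} :=
  [ffun g => x (f g)].

Definition augmentation_ideal G : set {ffun G -> A} :=
  [set x | \sum_(g : G) x g = 0].
Fixpoint augmentation_power G (j : nat) : set {ffun G -> A} :=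
  if j is j'.+1 then
    [set x | exists (k : nat) (a b : 'I_k -> {ffun G -> A}),
       (forall i, @augmentation_power G j' (a i) /\ @augmentation_ideal G (b i))
       /\ x = \sum_(i < k) gmul (a i) (b i)]
  else setT.

End GroupRing.

Section Invariants.
Context (p : nat) (O : idomainType) (w : O).

Definition ord_w (x : O) : nat :=
  xget 0%N [set k | exists2 u, u \is a GRing.unit & x = u * w ^+ k].

(* normalised by ord_p(p) = 1 *)
Definition ord_p (x : O) : \bar rat :=
  if x == 0 then +oo%E else ((ord_w x)%:R / (ord_w p%:R)%:R)%:E.

Definition mu_inv (I : Type) (c : I -> O) : \bar rat :=
  xget +oo%E [set m | (exists i, ord_p (c i) = m) /\
                      forall i, (m <= ord_p (c i))%E].

Definition lambda_series (P : nat -> O) : nat :=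
  xget 0%N [set j | ord_p (P j) = mu_inv P /\
                    forall i, ord_p (P i) = mu_inv P -> (j <= i)%N].

Definition lambda_group (F : fieldType) (red : O -> F) (G : finGroupType)
    (theta : {ffun G -> O}) : nat :=
  xget 0%N [set j | exists (k : nat) (theta' : {ffun G -> O}),
    let bar : {ffun G -> F} := [ffun g => red (theta' g)] in
    [/\ ord_p (w ^+ k) = mu_inv theta,
        theta = gscale (w ^+ k) theta',
        augmentation_power (A := F) (G := G) j bar
      & forall i, augmentation_power (A := F) (G := G) i bar -> (i <= j)%N]].

(* x is the image of the power series P under T |-> g - 1 *)
Definition series_at (G : finGroupType) (g : G) (P : nat -> O)
    (x : {ffun G -> O}) : Prop :=
  forall k, exists M0, forall M, (M0 <= M)%N -> forall s : G,
    eq_mod w k ((\sum_(j < M) gscale (P j) (gpow (gdelta O g - gdelta O 1%g) j)) s)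
               (x s).

End Invariants.

Definition quaternion_algebra (B : falgType rat) : Prop :=
  exists (i j : B) (a b : rat),
    [/\ a != 0, b != 0, i * i = a%:A, j * j = b%:A
      & j * i = - (i * j) /\ basis_of fullv [:: 1; i; j; i * j]].

(* f induces an isomorphism from the scalar extension of B to F onto M_2(F) *)
Definition splitting (B : falgType rat) (F : fieldType)
    (f : {rmorphism B -> 'M[F]_2}) : Prop :=
  lin_span setT (range f) = setT.

Definition ramified_at (B : falgType rat) (q : nat) : Prop :=
  forall Zq : idomainType, padic_integers q Zq ->
    forall f : {rmorphism B -> 'M[{fraction Zq}]_2}, ~ splitting f.

Definition definite (R : realType) (B : falgType rat) : Prop :=
  forall f : {rmorphism B -> 'M[R]_2}, ~ splitting f.

Definition has_discriminant (B : falgType rat) (D : nat) : Prop :=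
  squarefree D /\ forall q, prime q -> ((q %| D)%N <-> ramified_at B q).

Definition Zinv (p : nat) : set rat :=
  [set c | exists (m : int) (k : nat), c = m%:~R / p%:R ^+ k].

Definition p_order (p : nat) (B : falgType rat) (S : set B) : Prop :=
  [/\ S 1, (forall x y, S x -> S y -> S (x * y)),
      (exists s : seq B, S = lin_span (Zinv p) [set x | x \in s])
    & lin_span setT S = setT].

Definition maximal_p_order (p : nat) (B : falgType rat) (S : set B) : Prop :=
  p_order p S /\ forall S' : set B, p_order p S' -> S `<=` S' -> S' = S.

(* The level is the index of the order in a maximal order containing it. *)
Definition eichler_p_order (p N : nat) (B : falgType rat) (S : set B) : Prop :=
  exists S1 S2 : set B,
    [/\ maximal_p_order p S1, maximal_p_order p S2, S = S1 `&` S2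
      & has_index S1 S N].

Definition units_of (B : nzRingType) (S : set B) : set B :=
  [set u | S u /\ exists v, [/\ S v, u * v = 1 & v * u = 1]].

Section Tree.
Context (Zp : idomainType).
Local Notation Qp := {fraction Zp}.

Definition is_lattice (L : set 'cV[Qp]_2) : Prop :=
  exists2 g : 'M[Qp]_2, g \in unitmx
    & L = [set g *m v | v in [set v : 'cV[Qp]_2 | forall i, integral_in (v i 0)]].

Definition homothety_class (L : set 'cV[Qp]_2) : set (set 'cV[Qp]_2) :=
  [set [set c *: v | v in L] | c in [set c | c != 0]].

(* A vertex is a homothety class of lattices. *)
Definition vertex (x : set (set 'cV[Qp]_2)) : Prop :=
  exists2 L, is_lattice L & x = homothety_class L.

Definition adjacent (p : nat) (x y : set (set 'cV[Qp]_2)) : Prop :=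
  exists L M, [/\ is_lattice L, is_lattice M,
    x = homothety_class L, y = homothety_class M
    & [set p%:R *: v | v in L] `<` M /\ M `<` L].

Definition tree_act (g : 'M[Qp]_2) (x : set (set 'cV[Qp]_2)) :
    set (set 'cV[Qp]_2) :=
  [set [set g *m v | v in L] | L in x].

End Tree.

(* The function attached to f by the Jacquet-Langlands correspondence, with
   eigenvalues a.  As p does not divide the level it lives on the vertices.
   T_p is the adjacency operator of the tree; for l <> p, T_l is the sum over
   R^x \ { x in R : nrd x in l p^Z }, where nrd x = det (phi x). *)
Definition jacquet_langlands (p N : nat) (B : falgType rat) (S : set B)
    (Zp : idomainType) (phi : B -> 'M[{fraction Zp}]_2)
    (O : idomainType) (w : O) (a : nat -> O)
    (h : set (set 'cV[{fraction Zp}]_2) -> O) : Prop :=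
  [/\ (forall u x, units_of S u -> vertex x -> h (tree_act (phi u) x) = h x),
      (exists2 x, vertex x & ~ eq_mod w 1 (h x) 0),
      (forall x, vertex x ->
         \sum_(y \in [set y | adjacent p x y]) h y = a p * h x)
    & forall l, prime l -> ~~ (l %| N)%N -> l != p ->
        let X : set B := [set b | S b /\
          exists k : int, \det (phi b) = l%:R * p%:R ^ k] in
        forall s : seq B, (forall b, b \in s -> X b) ->
        (forall b, X b -> exists! i : 'I_(size s),
           exists2 u, units_of S u & b = u * nth 0 s i) ->
        forall x, vertex x ->
          \sum_(b <- s) h (tree_act (phi b) x) = a l * h x].

Section Torus.
Context (p : nat) (K : fieldExtType rat) (Zp : idomainType).
Local Notation Qp := {fraction Zp}.
(* emb : K -> M_2(Q_p); its Q_p-span is K_p. *)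
Context (emb : K -> 'M[Qp]_2).

Definition Kp_units : set 'M[Qp]_2 :=
  [set x | x \in unitmx /\ lin_span setT (range emb) x].

Definition OKp : set 'M[Qp]_2 :=
  lin_span (@integral_in Zp) [set emb x | x in @algebraic_integers K].

(* Preimage in K_p^x of U_n = (1 + p^n O_{K,p})^x / (1 + p^n Z_p)^x, a subgroup
   of K_p^x / Q_p^x. *)
Definition U (n : nat) : set 'M[Qp]_2 :=
  [set x | exists (c : Qp) (u : 'M[Qp]_2),
     [/\ c != 0, u \in unitmx, x = c *: u
       & (exists2 y, OKp y & u = 1 + p%:R ^+ n *: y) /\
         (exists2 y, OKp y & invmx u = 1 + p%:R ^+ n *: y)]].

Definition standard_vertices (v : nat -> set (set 'cV[Qp]_2)) : Prop :=
  [/\ forall n, vertex (v n), forall n, adjacent p (v n) (v n.+1)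
    & forall n x, Kp_units x -> (tree_act x (v n) = v n <-> U n x)].

(* q presents Gt as the quotient of K_p^x / Q_p^x by U_n and O_K[1/p]^x *)
Definition is_Gtilde (n : nat) (Gt : finGroupType) (q : 'M[Qp]_2 -> Gt) : Prop :=
  [/\ forall x y, Kp_units x -> Kp_units y -> q (x *m y) = (q x * q y)%g,
      forall t, exists2 x, Kp_units x & q x = t
    & forall x, Kp_units x -> (q x = 1%g <->
        exists u e, [/\ U n u, units_of (@p_integers p K) e & x = u *m emb e])].

Definition lift_Kp (Gt : finGroupType) (q : 'M[Qp]_2 -> Gt) (t : Gt) : 'M[Qp]_2 :=
  xget 1%:M [set x | Kp_units x /\ q x = t].

Definition theta_tilde (Gt : finGroupType) (q : 'M[Qp]_2 -> Gt) (O : idomainType)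
    (h : set (set 'cV[Qp]_2) -> O) (v : set (set 'cV[Qp]_2)) : {ffun Gt -> O} :=
  [ffun t => h (tree_act (lift_Kp q t^-1%g) v)].

End Torus.

Definition fixes_base (K : fieldType) (iK : K -> algC) (s : algC -> algC) : Prop :=
  forall x, s (iK x) = iK x.

(* Every ring endomorphism of algC is an automorphism, so that
   {rmorphism algC -> algC} is the absolute Galois group of Q.  The map res n
   presents G n as Gal(K_n / K), and pr n is the restriction
   Gal(K_{n+1} / K) -> Gal(K_n / K). *)
Record anticyclotomic_tower (p : nat) (K : fieldType) (iK : K -> algC)
    (Kn : nat -> set algC) (G : nat -> finGroupType)
    (res : forall n, {rmorphism algC -> algC} -> G n)
    (pr : forall n, G n.+1 -> G n) : Prop := AnticyclotomicTower {
  tower_sub : forall n x y, Kn n x -> Kn n y -> Kn n (x - y);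
  tower_div : forall n x y, Kn n x -> Kn n y -> Kn n (x / y);
  tower_base : forall n, range iK `<=` Kn n;
  tower_incl : forall n, Kn n `<=` Kn n.+1;
  tower_res_mul : forall n (s t u : {rmorphism algC -> algC}),
    fixes_base iK s -> fixes_base iK t -> (forall x, u x = s (t x)) ->
    res n u = (res n s * res n t)%g;
  tower_res_onto : forall n (g : G n),
    exists2 s : {rmorphism algC -> algC}, fixes_base iK s & res n s = g;
  tower_res_ker : forall n (s : {rmorphism algC -> algC}), fixes_base iK s ->
    (res n s = 1%g <-> forall x, Kn n x -> s x = x);
  tower_pr : forall n (s : {rmorphism algC -> algC}),
    fixes_base iK s -> pr n (res n.+1 s) = res n s;
  tower_card : forall n, #|{: G n}| = (p ^ n)%N;
  tower_cyclic : forall n, exists g : G n, forall x, x \in <[g]>%g;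
  tower_anti : forall n (s t : {rmorphism algC -> algC}), fixes_base iK s ->
    (forall x : algC, t (x^*) = (s x)^*) -> res n t = (res n s)^-1%g
}.

(* q is a prime of O_K[1/p], i.e. a prime of K not above p, and s is a Frobenius
   automorphism at some prime of algC above q. *)
Definition frobenius_at (p : nat) (K : fieldType) (iK : K -> algC) (q : set K)
    (s : algC -> algC) : Prop :=
  fixes_base iK s /\
  exists (Q : set algC) (k : nat),
    [/\ prime_ideal (@algebraic_integers algC) Q,
        forall x, @algebraic_integers K x -> (Q (iK x) <-> q x),
        has_index (@p_integers p K) q k
      & forall x, algebraic_integers x -> Q (s x - x ^+ k)].

(* rec n is the component in Gal(K_n / K) of the restriction to K_p^x (modulo
   Q_p^x) of the Artin map.  The Artin map kills K^x and K_n / K is unramified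
   outside p, so for y in O_K[1/p] with y O_K[1/p] a product of primes q_i, rec y
   is the inverse of the product of the Frobenius at the q_i.  By continuity and
   density of K in K_p this determines rec. *)
Record reciprocity_map (p : nat) (K : fieldExtType rat) (iK : K -> algC)
    (Zp : idomainType) (emb : K -> 'M[{fraction Zp}]_2) (G : nat -> finGroupType)
    (res : forall n, {rmorphism algC -> algC} -> G n)
    (pr : forall n, G n.+1 -> G n)
    (rec : forall n, 'M[{fraction Zp}]_2 -> G n) : Prop := ReciprocityMap {
  rec_mul : forall n x y, Kp_units emb x -> Kp_units emb y ->
    rec n (x *m y) = (rec n x * rec n y)%g;
  rec_scalar : forall n (c : {fraction Zp}), c != 0 -> rec n c%:M = 1%g;
  rec_pr : forall n x, Kp_units emb x -> pr n (rec n.+1 x) = rec n x;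
  rec_continuous : forall n, exists m, forall x, U p emb m x -> rec n x = 1%g;
  rec_artin : forall n (y : K) (k : nat) (q : 'I_k -> set K)
      (s : 'I_k -> {rmorphism algC -> algC}),
    @p_integers p K y -> y != 0 ->
    (forall i, [/\ prime_ideal (@p_integers p K) (q i),
                   exists2 x, q i x & x != 0
                 & frobenius_at p iK (q i) (s i)]) ->
    principal (@p_integers p K) y =
      \big[@ideal_mul K/@p_integers p K]_(i < k) q i ->
    rec n (emb y) = ((\prod_(i < k) res n (s i))^-1)%g
}.

(* Gt m --> G n induced by rec, for m such that rec kills U_m *)
Definition theta_level (K : fieldExtType rat) (Zp : idomainType)
    (emb : K -> 'M[{fraction Zp}]_2) (Gt Gn : finGroupType)
    (q : 'M[{fraction Zp}]_2 -> Gt) (rec : 'M[{fraction Zp}]_2 -> Gn)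
    (O : idomainType) (h : set (set 'cV[{fraction Zp}]_2) -> O)
    (v : set (set 'cV[{fraction Zp}]_2)) : {ffun Gn -> O} :=
  gpush (fun t => rec (lift_Kp emb q t)) (theta_tilde emb q h v).

(* The alpha-stabilised element at level n.+1 *)
Definition theta_stab (O : idomainType) (alpha : O) (G : nat -> finGroupType)
    (pr : forall n, G n.+1 -> G n) (L : forall n, {ffun G n -> O}) (n : nat) :
    {ffun G n.+1 -> O} :=
  gscale (alpha ^- n.+1) (L n.+1 - gscale alpha^-1 (gnorm (@pr n) (L n))).

(* Main.v *)
Require Import Defs.
From HB Require Import structures.
From mathcomp Require Import all_boot all_order all_algebra all_fingroup all_solvable all_field.
From mathcomp Require Import complex.
From mathcomp Require Import all_classical all_reals all_analysis.
Import Order.TTheory GRing.Theory Num.Theory.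
Import numFieldNormedType.Exports.
Local Open Scope classical_set_scope.
Local Open Scope ring_scope.

(* Modulo w the group ring of the cyclic p-group G_n, generated by g, is
   F[X] / (X - 1)^(p^n) with X mapping to g, and the powers of the augmentation
   ideal are generated by the powers of X - 1.  The lambda invariant is thus the
   valuation at X - 1, truncated at p^n, and it is invariant under iota.  Hence
   the reduction of the stabilised element at level n+1 has valuation
   lambda(L_p) / 2 as soon as p^(n+1) > lambda(L_p).  Up to a unit it differs from
   the reduction of L_(n+1) by a norm from level n, which is killed by
   g^(p^n) - 1 = (g - 1)^(p^n) and so has valuation at least p^(n+1) - p^n;
   for large n this exceeds lambda(L_p) / 2. *)

(** * The group ring of a cyclic group as a quotient of the polynomial ring *)

Section CyclicGroupRing.
Context {A : comNzRingType} {G : finGroupType} (g : G).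
Implicit Types (P Q : {poly A}) (x y : {ffun G -> A}).

(** Evaluation of [Q] at [g] in the group ring. As [gmul] is a bare operation, the value is given
    coefficientwise. *)
Definition gpoly Q : {ffun G -> A} :=
  [ffun s => \sum_(i < size Q | (g ^+ i == s)%g) Q`_i].

Lemma gpoly_wide m Q s : (size Q <= m)%N ->
  gpoly Q s = \sum_(i < m | (g ^+ i == s)%g) Q`_i.
Proof.
move=> Qm; rewrite ffunE (big_ord_widen_cond _ (fun i => (g ^+ i == s)%g) _ Qm).
rewrite [RHS](bigID (fun i : 'I_m => (i < size Q)%N)) /=.
by rewrite [X in _ + X]big1 ?addr0 // => i /andP[_]; rewrite -leqNgt => /(nth_default 0).
Qed.

Lemma gpolyD P Q s : gpoly (P + Q) s = gpoly P s + gpoly Q s.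
Proof.
pose m := maxn (size P) (size Q).
rewrite !(@gpoly_wide m) ?leq_maxl ?leq_maxr ?size_polyD // -big_split /=.
by apply: eq_bigr => i _; rewrite coefD.
Qed.

Lemma gpolyZ c P s : gpoly (c *: P) s = c * gpoly P s.
Proof.
rewrite (@gpoly_wide (size P)) ?size_scale_leq // ffunE big_distrr /=.
by apply: eq_bigr => i _; rewrite coefZ.
Qed.

Lemma gpoly_sum I (r : seq I) (Q : I -> {poly A}) s :
  gpoly (\sum_(i <- r) Q i) s = \sum_(i <- r) gpoly (Q i) s.
Proof.
apply: (big_rec2 (fun P c => gpoly P s = c)) => [|i P c _ <-].
  by rewrite ffunE size_poly0 big_ord0.
by rewrite gpolyD.
Qed.

Lemma gpolyMX P s : gpoly (P * 'X) s = gpoly P (g^-1 * s)%g.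
Proof.
rewrite (@gpoly_wide (size P).+1); last first.
  have [->|P0] := eqVneq P 0; first by rewrite mul0r size_poly0.
  by rewrite size_mulX.
rewrite ffunE big_mkcond big_ord_recl /= coefMX /= if_same add0r [RHS]big_mkcond.
apply: eq_bigr => i _; rewrite coefMX /= expgS.
by rewrite (canF_eq (mulKg g)).
Qed.

Lemma gpoly1 : gpoly 1 = gdelta A 1%g.
Proof.
apply/ffunP => s; rewrite !ffunE size_poly1 big_mkcond big_ord1 /=.
by rewrite coef1 expg0 eq_sym; case: eqP.
Qed.

Lemma gpolyC c s : gpoly c%:P s = c * gdelta A 1%g s.
Proof. by rewrite -gpoly1 -gpolyZ -mul_polyC mulr1. Qed.

Lemma gpolyX : gpoly 'X = gdelta A g.
Proof.
apply/ffunP => s; rewrite -[X in gpoly X]mul1r gpolyMX gpoly1 !ffunE.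
by rewrite (can2_eq (mulKVg g) (mulKg g)) mulg1.
Qed.

(** Horner induction on [P]: a factor ['X] acts as translation by [g], which the convolution sum
    absorbs by reindexing. *)
Lemma gpolyM P Q : gpoly (P * Q) = gmul (gpoly P) (gpoly Q).
Proof.
elim/poly_ind: P => [|P c IH]; apply/ffunP => s.
  rewrite mul0r !ffunE size_poly0 big_ord0 big1 // => k _.
  by rewrite ffunE size_poly0 big_ord0 mul0r.
rewrite mulrDl gpolyD -mulrA (mulrC 'X) mulrA gpolyMX IH mul_polyC gpolyZ.
rewrite [gmul _ _ _]ffunE [RHS]ffunE.
under [RHS]eq_bigr do rewrite gpolyD mulrDl gpolyMX gpolyC.
rewrite big_split /=; congr (_ + _).
  rewrite [RHS](reindex_inj (mulgI g)) /=.
  by apply: eq_bigr => k _; rewrite mulKg invMg mulgA.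
rewrite (bigD1 1%g) //= big1 ?addr0 => [|k /negPf k1].
  by rewrite [gdelta _ _ _]ffunE eqxx mulr1 invg1 mul1g.
by rewrite ffunE k1 mulr0 mul0r.
Qed.

Lemma gpolyXn n : gpoly 'X^n = gdelta A (g ^+ n)%g.
Proof.
elim: n => [|n IH]; first by rewrite gpoly1.
apply/ffunP => s; rewrite exprSr gpolyMX IH !ffunE expgS.
by rewrite (can2_eq (mulKVg g) (mulKg g)).
Qed.

Lemma gpoly_XsubC1 : gpoly ('X - 1%:P) = gdelta A g - gdelta A 1%g.
Proof.
apply/ffunP => s; rewrite -scaleN1r gpolyD gpolyX gpolyZ gpoly1.
by rewrite !ffunE mulN1r.
Qed.

Lemma gpoly_exp Q j : gpoly (Q ^+ j) = gpow (gpoly Q) j.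
Proof. by elim: j => [|j IH]; rewrite ?gpoly1 // exprS gpolyM IH. Qed.

(** Through this the augmentation ideal becomes the ideal of polynomials with root 1. *)
Lemma sum_gpoly Q : \sum_s gpoly Q s = Q.[1].
Proof.
rewrite horner_coef; under eq_bigr do rewrite ffunE.
rewrite (exchange_big_dep xpredT) //=; apply: eq_bigr => i _.
by rewrite (big_pred1 (g ^+ i)%g) ?expr1n ?mulr1 // => s; rewrite eq_sym.
Qed.

Hypothesis g_gen : forall s, s \in <[g]>%g.

Lemma gpoly_coef Q i : (size Q <= #[g]%g)%N -> (i < #[g]%g)%N ->
  gpoly Q (g ^+ i)%g = Q`_i.
Proof.
move=> Qm im; rewrite (gpoly_wide _ _ _ Qm).
rewrite (bigD1 (Ordinal im)) //= big1 ?addr0 // => j /andP[].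
by rewrite (@eq_expg_ord _ _ _ j (Ordinal im)) // => /eqP-> /eqP.
Qed.

Lemma gpoly_surj x : exists Q, gpoly Q = x.
Proof.
exists (\poly_(i < #[g]%g) x (g ^+ i)%g); apply/ffunP => s.
have /cyclePmin[j jm ->] := g_gen s.
by rewrite gpoly_coef ?size_poly // coef_poly jm.
Qed.

(** Inversion reverses products; the order is restored because a cyclic group is abelian. *)
Lemma giota_gmul x y : giota (gmul x y) = gmul (giota x) (giota y).
Proof.
apply/ffunP => s; rewrite !ffunE (reindex_inj invg_inj) /=.
apply: eq_bigr => k _; rewrite !ffunE invgK invMg invgK.
have /cycleP[i ->] := g_gen k; have /cycleP[j ->] := g_gen s.
by congr (_ * y _); rewrite -expgVn; exact: commuteX2 (commuteV (commute_refl g)).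
Qed.

Lemma augmentation_power_giota j x :
  augmentation_power j x -> augmentation_power j (giota x).
Proof.
elim: j x => //= j IH _ [k [a [b [ab ->]]]].
exists k, (fun i => giota (a i)), (fun i => giota (b i)); split=> [i|].
  have [/IH ? bi] := ab i; split=> //=.
  rewrite /augmentation_ideal/= (reindex_inj invg_inj) -[RHS]bi.
  by apply: eq_bigr => s _; rewrite ffunE invgK.
apply/ffunP => s; rewrite ffunE !sum_ffunE.
by apply: eq_bigr => i _; rewrite /= -giota_gmul [RHS]ffunE.
Qed.

End CyclicGroupRing.

(** * Change of coefficients *)

Lemma map_gpoly {A B : comNzRingType} (f : {rmorphism A -> B})
    {G : finGroupType} (g : G) (Q : {poly A}) s :
  f (gpoly g Q s) = gpoly g (map_poly f Q) s.
Proof.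
rewrite (gpoly_wide _ _ _ _ (size_poly _ _)) ffunE rmorph_sum /=.
by apply: eq_bigr => i _; rewrite coef_map.
Qed.

Lemma map_gmul {A B : comNzRingType} (f : {rmorphism A -> B})
    {G : finGroupType} (x y : {ffun G -> A}) s :
  f (gmul x y s) = gmul [ffun t => f (x t)] [ffun t => f (y t)] s.
Proof.
rewrite [gmul x y s]ffunE [RHS]ffunE rmorph_sum.
by apply: eq_bigr => t _; rewrite rmorphM /= !ffunE.
Qed.

Lemma map_giota {A B : comNzRingType} (f : A -> B) {G : finGroupType}
    (x : {ffun G -> A}) :
  [ffun t => f (giota x t)] = giota [ffun t => f (x t)].
Proof. by apply/ffunP => t; rewrite !ffunE. Qed.

(** * The group algebra of a cyclic p-group in characteristic p *)

Section CyclicPGroupAlgebra.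
Context {F : fieldType} {G : finGroupType} {g : G} {p n : nat}.
Hypotheses (g_gen : forall s, s \in <[g]>%g) (p_char : p \in [pchar F]).
Hypothesis g_order : #[g]%g = (p ^ n)%N.
Implicit Types (P Q : {poly F}) (x y : {ffun G -> F}).
Local Notation D := ('X - 1%:P : {poly F}).

Lemma XpnB1 m : 'X^(p ^ m) - 1 = D ^+ (p ^ m) :> {poly F}.
Proof.
have pX : p \in [pchar {poly F}] by rewrite pchar_poly.
elim: m => [|m IH]; first by rewrite expr1.
rewrite expnSr !exprM -IH -!(pFrobenius_autE pX) pFrobenius_autB_comm //.
  by rewrite pFrobenius_aut1.
exact: mulrC.
Qed.

(** The relation [g ^+ (p ^ n) = 1] kills ['X^(p ^ n) - 1], which is [D ^+ (p ^ n)] by Frobenius.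
    Conversely the remainder of [Q] has degree below the order of [g], so its coefficients can be
    read off from its image. *)
Lemma gpoly_eq0 Q : gpoly g Q = 0 <-> D ^+ (p ^ n) %| Q.
Proof.
have DN : gpoly g (D ^+ (p ^ n)) = 0.
  rewrite -XpnB1 -g_order; apply/ffunP => s.
  by rewrite -scaleN1r gpolyD gpolyZ gpolyXn expg_order gpoly1 mulN1r subrr ffunE.
have Mz P : gpoly g (P * D ^+ (p ^ n)) = 0.
  rewrite gpolyM DN; apply/ffunP => s; rewrite !ffunE big1 // => k _.
  by rewrite [X in _ * X]ffunE mulr0.
split=> [Q0|/dvdpP[P ->]//].
have Dn0 : D ^+ (p ^ n) != 0 by rewrite expf_neq0 // polyXsubC_eq0.
rewrite /dvdp; apply/eqP/polyP => i; rewrite coef0.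
have szR : (size (Q %% D ^+ (p ^ n))%R <= #[g]%g)%N.
  by rewrite g_order -ltnS -(size_exp_XsubC (p ^ n) (1 : F)) ltn_modp.
have R0 : gpoly g (Q %% D ^+ (p ^ n)) = 0.
  apply/ffunP => s; move/ffunP/(_ s): Q0.
  by rewrite {1}(divp_eq Q (D ^+ (p ^ n))) gpolyD Mz ffunE add0r.
have [lt_i|le_i] := ltnP i #[g]%g.
  by rewrite -(gpoly_coef _ _ _ szR lt_i) R0 ffunE.
by rewrite nth_default // (leq_trans szR).
Qed.

(** By the factor theorem the augmentation ideal is principal, generated by the image of [D]. *)
Lemma augmentation_powerE j x :
  augmentation_power j x <-> exists P, x = gpoly g (D ^+ j * P).
Proof.
elim: j x => [|j IH] x /=.
  split=> // _; have [Q' <-] := gpoly_surj _ g_gen x.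
  by exists Q'; rewrite expr0 mul1r.
split=> [[k [a [b [ab ->]]]]|[P ->]].
  have ex i : exists P, gmul (a i) (b i) = gpoly g (D ^+ j.+1 * P).
    have [/IH[P ->]] := ab i; have [P' <-] := gpoly_surj _ g_gen (b i).
    rewrite /augmentation_ideal /= sum_gpoly => /eqP.
    rewrite -/(root P' 1) -dvdp_XsubCl => /dvdpP[P'' ->].
    by exists (P * P''); rewrite -gpolyM exprSr -!mulrA (mulrC P'') (mulrCA P).
  have [P PE] := choice ex.
  exists (\sum_i P i); apply/ffunP => s.
  rewrite big_distrr /= gpoly_sum sum_ffunE.
  by apply: eq_bigr => i _; rewrite PE.
exists 1%N, (fun=> gpoly g (D ^+ j * P)), (fun=> gpoly g D).
split=> [_|]; last by rewrite big_ord1 -gpolyM exprSr mulrAC.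
split; first by apply/IH; exists P.
by rewrite /augmentation_ideal /= sum_gpoly !hornerE subrr.
Qed.

Lemma augmentation_power_leq i j x : (i <= j)%N ->
  augmentation_power j x -> augmentation_power i x.
Proof.
move=> ij /augmentation_powerE[P ->]; apply/augmentation_powerE.
by exists (D ^+ (j - i) * P); rewrite mulrA -exprD subnKC.
Qed.

Lemma gpoly_eqP P Q : gpoly g P = gpoly g Q <-> D ^+ (p ^ n) %| P - Q.
Proof.
rewrite -gpoly_eq0; split=> [PQ|/ffunP PQ]; apply/ffunP => s.
  by rewrite -scaleN1r gpolyD gpolyZ PQ mulN1r subrr ffunE.
apply/eqP; rewrite -subr_eq0 -mulN1r -gpolyZ -gpolyD scaleN1r PQ.
by rewrite ffunE.
Qed.

Lemma dvdp_gpoly j P Q : (j <= p ^ n)%N -> gpoly g P = gpoly g Q ->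
  (D ^+ j %| P) = (D ^+ j %| Q).
Proof.
move=> jn /gpoly_eqP/(dvdp_trans (dvdp_exp2l D jn)) jPQ.
by rewrite -[P in LHS](subrK Q) dvdp_addr.
Qed.

(** For larger [j] the augmentation power is zero and only detects divisibility by
    [D ^+ (p ^ n)]. *)
Lemma augmentation_power_gpoly j Q : (j <= p ^ n)%N ->
  augmentation_power j (gpoly g Q) <-> D ^+ j %| Q.
Proof.
move=> jn; rewrite augmentation_powerE; split=> [[P eqQ]|/dvdpP[P ->]].
  by rewrite (dvdp_gpoly _ _ _ jn eqQ) dvdp_mulr.
by exists P; rewrite mulrC.
Qed.

(* The unqualified gnorm is a rewriting rule of fingroup. *)
Lemma gpoly_gnorm (H : finGroupType) (f : G -> H) (y : {ffun H -> F}) m Q :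
    {morph f : s t / (s * t)%g} -> f (g ^+ (p ^ m))%g = 1%g -> (m <= n)%N ->
  gpoly g Q = Defs.gnorm f y -> D ^+ (p ^ n - p ^ m) %| Q.
Proof.
move=> fM fg1 mn Qy.
have pn : (p ^ m <= p ^ n)%N by rewrite leq_exp2l // prime_gt1 ?(pcharf_prime p_char).
have D0 k : D ^+ k != 0 by rewrite expf_neq0 // polyXsubC_eq0.
(* It remains to see that ['X^(p ^ m) - 1] kills the norm, i.e. that the norm is invariant under
   translation by [g ^+ (p ^ m)], an element that [f] sends to 1. *)
rewrite -(dvdp_mul2r _ _ (D0 (p ^ m)%N)) -exprD subnK // -gpoly_eq0 -XpnB1.
apply/ffunP => s; rewrite mulrBr mulr1 -scaleN1r gpolyD gpolyZ mulN1r.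
have MXn k t : gpoly g (Q * 'X^k) t = gpoly g Q (g ^- k * t)%g.
  elim: k t => [|k IH] t; first by rewrite mulr1 expg0 invg1 mul1g.
  by rewrite exprSr mulrA gpolyMX IH mulgA -invMg -expgS.
rewrite MXn Qy !ffunE.
have f1 : f 1%g = 1%g by apply: (mulgI (f 1%g)); rewrite -fM !mulg1.
rewrite fM (_ : f (g ^- _)%g = 1%g) ?mul1g ?subrr //.
by apply: (mulgI (f (g ^+ (p ^ m))%g)); rewrite -fM mulgV f1 fg1 mulg1.
Qed.

(* The involution preserves the filtration, so both factors of x * iota x have
   the same valuation at X - 1. *)
Lemma mup_gmul_giota (c : nat -> F) (l M : nat) P x :
    gpoly g P = x -> c l != 0 -> (forall i, (i < l)%N -> c i = 0) ->
    (l < p ^ n)%N -> (l < M)%N ->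
    gpoly g (\sum_(j < M) c j *: D ^+ j) = gmul x (giota x) ->
  exists2 a, (2 * a)%N = l & D ^+ a %| P /\ ~~ (D ^+ a.+1 %| P).
Proof.
move=> Px cl0 cl_lt ln lM.
have [P' P'x] := gpoly_surj _ g_gen (giota x).
rewrite -P'x -Px -gpolyM => cPP'.
have D1 : (1 < size D)%N by rewrite size_XsubC.
pose Q := \sum_(j < M) c j *: D ^+ j.
(* Lower coefficients vanish and higher terms are multiples of [D ^+ l.+1]. *)
have Ql : D ^+ l.+1 %| Q - c l *: D ^+ l.
  rewrite /Q (bigD1 (Ordinal lM)) //= addrC addrK.
  apply: (big_ind (fun P => D ^+ l.+1 %| P)) => [|P1 P2|i il]; [exact: dvdp0|by move=> dP1 dP2; rewrite dvdp_addr|].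
  have [/cl_lt->|] := ltnP i l; first by rewrite scale0r dvdp0.
  rewrite leq_eqVlt => /orP[/eqP li|li]; first by case/eqP: il; apply/val_inj.
  by rewrite -mul_polyC dvdp_mull ?dvdp_exp2l //.
(* The product is known only modulo [D ^+ (p ^ n)]; since [l < p ^ n], the exponent [l.+1] can still
   be tested. *)
have vall j : (j <= p ^ n)%N -> (D ^+ j %| P * P') = (j <= l)%N.
  move=> jn; rewrite -(dvdp_gpoly _ _ _ jn cPP') -/Q.
  have [jl|lj] := leqP j l.
    rewrite -[Q](subrK (c l *: D ^+ l)) dvdp_addr ?dvdpZr ?dvdp_exp2l //.
    by rewrite (dvdp_trans _ Ql) // dvdp_exp2l // leqW.
  apply/negP => /(dvdp_trans (dvdp_exp2l D lj)).
  rewrite -[Q](subrK (c l *: D ^+ l)) dvdp_addr // dvdpZr //.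
  by rewrite dvdp_Pexp2l // ltnn.
have /negP PP'n : ~~ (D ^+ l.+1 %| P * P') by rewrite vall // ltnn.
have Pn0 : P != 0 by apply/eqP => P0; apply: PP'n; rewrite P0 mul0r dvdp0.
have P'n0 : P' != 0 by apply/eqP => P0; apply: PP'n; rewrite P0 mulr0 dvdp0.
have PP'0 : P * P' != 0 by rewrite mulf_neq0.
have mupl : mup 1 (P * P') = l.
  by apply/eqP; rewrite eqn_leq mup_leq // mup_geq // !vall // ?ltnn ?leqnn // ltnW.
have eqv j : (j <= p ^ n)%N -> (j <= mup 1 P')%N = (j <= mup 1 P)%N.
  move=> jn; rewrite !mup_geq //; apply/idP/idP => /(augmentation_power_gpoly _ _ jn).
    move=> /(augmentation_power_giota _ g_gen); rewrite P'x.
    have -> : giota (giota x) = x by apply/ffunP => s; rewrite !ffunE invgK.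
    by rewrite -Px => /(augmentation_power_gpoly _ _ jn).
  move=> /(augmentation_power_giota _ g_gen).
  by rewrite Px -P'x => /(augmentation_power_gpoly _ _ jn).
rewrite mupM // in mupl.
exists (mup 1 P); last by rewrite -mup_geq // -mup_leq // leqnn.
(* Both multiplicities are at most [l < p ^ n], within the range where [eqv] compares them. *)
suff eqm : mup 1 P' = mup 1 P by rewrite mul2n -addnn -{2}eqm.
apply/eqP; rewrite eqn_leq -eqv ?leqnn /=; last first.
  by rewrite (leq_trans _ (ltnW ln)) // -mupl leq_addl.
by rewrite eqv // (leq_trans _ (ltnW ln)) // -mupl leq_addr.
Qed.

End CyclicPGroupAlgebra.

(** * Iwasawa invariants read off from the reduction modulo the uniformizer *)

Section ResidualInvariants.
Context {O : idomainType} {w : O} {F : fieldType} {red : {rmorphism O -> F}}.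
Context {p : nat}.
Hypotheses (w_dvr : complete_dvr w) (F_res : residue_field w red).
Hypotheses (p_neq0 : p%:R != 0 :> O) (red_p : red p%:R = 0).

(** The exponent is unique: cancelling the smaller power would make a positive power of [w] a
    unit. *)
Lemma ord_w_unit_exp (u : O) k : u \is a GRing.unit -> ord_w w (u * w ^+ k) = k.
Proof.
have [w0 w_nonunit _ _] := w_dvr.
have exp_inj u1 u2 i j : u1 \is a GRing.unit -> u2 \is a GRing.unit ->
    u1 * w ^+ i = u2 * w ^+ j -> (j <= i)%N.
  move=> u1U u2U eqw; rewrite leqNgt; apply: contra w_nonunit => ij.
  have : u1 = u2 * w ^+ (j - i).
    apply: (mulIf (expf_neq0 i w0)).
    by rewrite eqw -mulrA -exprD subnK // ltnW.
  move: u1U => /[swap] ->; rewrite unitrM => /andP[_].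
  by rewrite unitrX_pos // subn_gt0.
move=> uU; apply: xget_unique => [|j [u' u'U eqw]]; first by exists u.
by apply/eqP; rewrite eqn_leq (exp_inj _ _ _ _ _ _ eqw) // (exp_inj _ _ _ _ _ _ (esym eqw)).
Qed.

Lemma red_neq0 x : (red x != 0) = (x \is a GRing.unit).
Proof.
have [w0 w_nonunit w_fact _] := w_dvr; have [_ red0] := F_res.
apply/idP/idP => [rx|/(rmorph_unit red)]; last by rewrite unitfE.
have [x0|/w_fact[[|k] [u [uU xE]]]] := eqVneq x 0.
- by rewrite x0 rmorph0 eqxx in rx.
- by rewrite xE mulr1.
- case/eqP: rx; apply/red0; exists (u * w ^+ k).
  by rewrite subr0 xE exprS mulrCA.
Qed.

Lemma ord_p_ge0 x : (0 <= ord_p p w x)%E.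
Proof.
by rewrite /ord_p; case: ifP => _; rewrite ?leey // lee_fin divr_ge0 // ler0n.
Qed.

Lemma ord_p_eq0 x : ord_p p w x = 0%E <-> red x != 0.
Proof.
have [w0 w_nonunit w_fact _] := w_dvr.
have [k [u [uU pE]]] := w_fact _ p_neq0.
(* Division by zero gives zero, so [ord_p] would vanish at every nonzero element if [p] were a
   unit. *)
have k0 : k != 0%N.
  by apply: contraTneq uU => k0; rewrite -red_neq0 -[u]mulr1 -(expr0 w) -k0 -pE red_p eqxx.
rewrite /ord_p red_neq0; have [->|/w_fact[j [v [vU ->]]]] := eqVneq x 0.
  by rewrite unitr0.
rewrite pE !ord_w_unit_exp // unitrM vU /=; split=> [[/eqP]|].
  rewrite mulf_eq0 invr_eq0 !pnatr_eq0 (negPf k0) orbF => /eqP->.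
  exact: unitr1.
case: j => [|j]; first by rewrite mul0r.
by rewrite unitrX_pos // (negPf w_nonunit).
Qed.

Lemma mu_inv_eq0 (I : Type) (c : I -> O) :
  mu_inv p w c = 0%E <-> exists i, red (c i) != 0.
Proof.
split=> [|[i /ord_p_eq0 ci]].
  (* The default [+oo] differs from 0, so the minimum is attained. *)
  rewrite /mu_inv; case: xgetP => // _ -> [[i ci] _] ci0.
  by exists i; apply/ord_p_eq0; rewrite ci.
apply: xget_unique => [|m [[j <-] mP]].
  by split=> [|j]; [exists i | apply: ord_p_ge0].
by apply/le_anti; rewrite ord_p_ge0 andbT -ci mP.
Qed.

Lemma lambda_series_eq (P : nat -> O) l : mu_inv p w P = 0%E ->
  red (P l) != 0 -> (forall i, (i < l)%N -> red (P i) = 0) ->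
  lambda_series p w P = l.
Proof.
move=> mu0 Pl P_lt.
have minl i : ord_p p w (P i) = 0%E -> (l <= i)%N.
  by move=> /ord_p_eq0; rewrite leqNgt; apply: contra => /P_lt->.
rewrite /lambda_series mu0; apply: xget_unique => [|j [Pj minj]].
  by split=> //; apply/ord_p_eq0.
by apply/eqP; rewrite eqn_leq minl // minj //; apply/ord_p_eq0.
Qed.

(** With mu equal to 0 the scaling exponent in [lambda_group] must be 0, as [w] is not a unit; hence
    [theta'] is [theta] itself. *)
Lemma lambda_group_eq (G : finGroupType) (theta : {ffun G -> O}) a :
    let bar := [ffun g => red (theta g)] : {ffun G -> F} in
    mu_inv p w theta = 0%E -> augmentation_power a bar ->
    (forall i, augmentation_power i bar -> (i <= a)%N) ->
  lambda_group p w red theta = a.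
Proof.
move=> bar mu0 a_bar max_a; apply: xget_unique => [|j [k [theta' []]]].
  exists 0%N, theta; split=> //.
    by rewrite mu0; apply/ord_p_eq0; rewrite expr0 rmorph1 oner_eq0.
  by apply/ffunP => g; rewrite ffunE mul1r.
rewrite mu0 => /ord_p_eq0; rewrite red_neq0.
case: k => [_|k]; last first.
  have [_ /negPf wU _ _] := w_dvr; by rewrite unitrX_pos // wU.
move=> eq_theta; have -> : theta' = theta.
  by rewrite eq_theta; apply/ffunP => g; rewrite ffunE mul1r.
by move=> a_j max_j; apply/eqP; rewrite eqn_leq max_a // max_j.
Qed.

End ResidualInvariants.

(** * Theta elements along the tower *)

Lemma tower_pr_morph {p : nat} {K : fieldType} {iK : K -> algC}
    {Kn : nat -> set algC} {G : nat -> finGroupType}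
    {res : forall n, {rmorphism algC -> algC} -> G n}
    {pr : forall n, G n.+1 -> G n} :
  anticyclotomic_tower p iK Kn res pr ->
  forall n, {morph @pr n : s t / (s * t)%g}.
Proof.
move=> tower n s t; have onto := tower_res_onto tower.
have prE := tower_pr tower; have resM := tower_res_mul tower.
(* Composing lifts to automorphisms over [K] computes the product at both levels. *)
have [sig sigK <-] := onto _ s; have [tau tauK <-] := onto _ t.
pose u : {rmorphism algC -> algC} := sig \o tau.
have uK : fixes_base iK u by move=> x; rewrite /u /= tauK sigK.
by rewrite -(resM _ sig tau u) // !prE // (resM _ sig tau u).
Qed.

(** The argument for an arbitrary family over a tower of cyclic p-groups: the arithmetic enters
    through the congruences with [Lp], taken modulo [w]. *)
Lemma theta_family_invariants (p : nat) (O : idomainType) (w : O) (F : fieldType)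
    (red : {rmorphism O -> F}) (G : nat -> finGroupType)
    (pr : forall n, G n.+1 -> G n) (g : forall n, G n) (alpha : O)
    (L : forall n, {ffun G n -> O}) (Lp : nat -> O) (s : nat) :
  prime p -> complete_dvr w -> residue_field w red ->
  p%:R != 0 :> O -> red p%:R = 0 -> alpha \is a GRing.unit ->
  (forall n, {morph @pr n : x y / (x * y)%g}) -> (forall n, pr n (g n.+1) = g n) ->
  (forall n x, x \in <[g n]>%g) -> (forall n, #|{: G n}| = (p ^ n)%N) ->
  (forall n, (s <= n)%N ->
     series_at w (g n.+1) Lp
       (gmul (theta_stab alpha pr L n) (giota (theta_stab alpha pr L n)))) ->
  mu_inv p w Lp = 0%E ->
  exists n0, forall n, (n0 <= n)%N ->
    mu_inv p w (L n) = 0%E /\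
    (2 * lambda_group p w red (L n))%N = lambda_series p w Lp.
Proof.
move=> p_prime w_dvr F_res p0 red_p alphaU prM pr_g g_gen cardG Lp_series mu0.
have p_char : p \in [pchar F] by rewrite inE p_prime -(rmorph_nat red) red_p eqxx.
have ordg n : #[g n]%g = (p ^ n)%N.
  by rewrite -cardG; apply: eq_card => x; rewrite g_gen.
have exLp : exists i, red (Lp i) != 0 by apply/(mu_inv_eq0 w_dvr F_res p0 red_p).
pose l := ex_minn exLp.
have [redl Lp_lt] : red (Lp l) != 0 /\ forall i, (i < l)%N -> red (Lp i) = 0.
  rewrite /l; case: ex_minnP => m redm minm; split=> // i.
  by rewrite ltnNge => im; apply/eqP/negPn; apply: contra im; apply: minm.
rewrite (lambda_series_eq w_dvr F_res p0 red_p _ _ mu0 redl Lp_lt).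
(* The successor appears because [theta_stab] of index [n] lives on level [n.+1]; from [l <= n]
   follows [l < p ^ n]. *)
exists (maxn s l).+1 => -[//|n]; rewrite ltnS geq_max => /andP[sn ln].
have p_gt1 := prime_gt1 p_prime.
have ln1 : (l < p ^ n)%N by rewrite (leq_ltn_trans ln) // ltn_expl.
have pn : (p ^ n + p ^ n <= p ^ n.+1)%N by rewrite addnn -mul2n expnS leq_mul2r p_gt1 orbT.
have [P PE] := gpoly_surj _ (g_gen n.+1) [ffun x => red (L n.+1 x)].
have [Y YE] := gpoly_surj _ (g_gen n.+1) (Defs.gnorm (pr n) [ffun x => red (L n x)]).
pose M x := red (theta_stab alpha pr L n x).
pose c := red (alpha ^- n.+1); pose d := red alpha^-1.
have ME : gpoly (g n.+1) (c *: (P - d *: Y)) = [ffun x => M x].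
  apply/ffunP => x; rewrite -scaleNr gpolyZ gpolyD gpolyZ PE YE !ffunE.
  by rewrite /M !ffunE rmorphM rmorphB rmorphM mulNr.
have c0 : c != 0 by rewrite (red_neq0 w_dvr F_res) unitrV unitrX.
(* Precision 1 is congruence modulo [w]. The truncation [m] also exceeds [l], to keep the leading
   term of the reduction. *)
have [M0 Lp_M] := Lp_series n sn 1%N.
pose m := maxn M0 l.+1.
have series_red : gpoly (g n.+1) (\sum_(j < m) red (Lp j) *: ('X - 1%:P) ^+ j) =
    gmul [ffun x => M x] (giota [ffun x => M x]).
  apply/ffunP => x; have := Lp_M m (leq_maxl _ _) x.
  move=> [z /(congr1 red)]; rewrite rmorphB rmorphM rmorphXn /=.
  have -> : red w = 0 by apply/eqP/negPn; rewrite (red_neq0 w_dvr F_res); case: w_dvr.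
  rewrite mul0r => /eqP; rewrite subr_eq0 => /eqP.
  rewrite map_gmul map_giota.
  move=> <-; rewrite gpoly_sum sum_ffunE rmorph_sum; apply: eq_bigr => j _.
  rewrite gpolyZ [in RHS]ffunE rmorphM; congr (_ * _).
  by rewrite -gpoly_XsubC1 -gpoly_exp map_gpoly rmorphXn /= map_polyXsubC (rmorph1 red).
have [a al [aP aP1]] := mup_gmul_giota (g_gen n.+1) p_char (ordg n.+1) _ _ _ _ _ ME
  redl Lp_lt (leq_trans ln1 (leq_trans (leq_addl _ _) pn)) (leq_maxr _ _) series_red.
(* Here [a <= l < p ^ n]. The strict bound makes the norm term divisible by the power [a.+1], so
   removing it changes neither divisibility by the power [a] nor its failure at [a.+1]. *)
have a_lt : (a < p ^ n.+1 - p ^ n)%N.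
  rewrite ltn_subRL (leq_trans _ pn) // ltn_add2l (leq_ltn_trans _ ln1) //.
  by rewrite -al leq_pmull.
have pr_g_expn k : pr n (g n.+1 ^+ k)%g = (g n ^+ k)%g.
  elim: k => [|k IH]; last by rewrite !expgS prM IH pr_g.
  by apply: (mulgI (pr n 1%g)); rewrite -prM !mulg1.
have aY : ('X - 1%:P) ^+ a.+1 %| Y.
  have pr1 : pr n (g n.+1 ^+ (p ^ n))%g = 1%g by rewrite pr_g_expn -ordg expg_order.
  have := gpoly_gnorm p_char (ordg n.+1) _ _ _ _ _ (prM n) pr1 (leqnSn n) YE.
  exact/dvdp_trans/dvdp_exp2l.
have dvdP j : (j <= a.+1)%N ->
    (('X - 1%:P) ^+ j %| c *: (P - d *: Y)) = (('X - 1%:P) ^+ j %| P).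
  move=> ja; rewrite dvdpZr // -scaleNr dvdp_addl //.
  by rewrite -mul_polyC dvdp_mull // (dvdp_trans (dvdp_exp2l _ ja) aY).
rewrite dvdP // in aP; rewrite dvdP // in aP1.
have aN : (a.+1 <= p ^ n.+1)%N by rewrite (leq_trans a_lt) // leq_subr.
have mu_L : mu_inv p w (L n.+1) = 0%E.
  (* Were the reduction zero, [P] would be divisible by the power [p ^ n.+1], which is at least
     [a.+1]. *)
  apply/(mu_inv_eq0 w_dvr F_res p0 red_p); apply: contrapT => L0.
  case/negP: aP1; apply: dvdp_trans (dvdp_exp2l _ aN) _.
  apply/(gpoly_eq0 p_char (ordg n.+1)); rewrite PE.
  apply/ffunP => x; rewrite !ffunE; apply/eqP/negPn/negP => Lx.
  by apply: L0; exists x.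
split=> //; rewrite -[RHS]al; congr (2 * _)%N.
have augE j (jN : (j <= p ^ n.+1)%N) :=
  augmentation_power_gpoly (g_gen n.+1) p_char (ordg n.+1) j P jN.
apply: (lambda_group_eq w_dvr F_res p0 red_p _ _ _ mu_L); rewrite -PE.
  by apply/augE => //; apply: ltnW.
move=> i Pi; rewrite leqNgt; apply/negP => ai; case/negP: aP1; apply/augE => //.
exact: augmentation_power_leq (g_gen n.+1) _ _ _ ai Pi.
Qed.

Theorem theoremA
  (R : realType) (p Np Nm : nat)
  (p_prime : prime p) (p_ge5 : (5 <= p)%N)
  (* the imaginary quadratic field and the level *)
  (K : fieldExtType rat) (iK : {rmorphism K -> algC})
  (K_imag : imaginary_quadratic iK) (p_unram : unramified K p)
  (Np_gt0 : (0 < Np)%N) (Nm_sqfree : squarefree Nm)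
  (Nm_odd : odd (size (primes Nm))) (p_N : ~~ (p %| Np * Nm)%N)
  (Np_split : forall q, prime q -> (q %| Np)%N -> splits K q)
  (Nm_inert : forall q, prime q -> (q %| Nm)%N -> inert K q)
  (* the newform f, with Fourier coefficients a_n generating the field E *)
  (f : cplx R -> cplx R)
  (E : fieldExtType rat) (iE : {rmorphism E -> cplx R}) (a : nat -> E)
  (f_newform : newform2 (Np * Nm) f (fun n => iE (a n)))
  (E_gen : forall S : {subfield E}, (forall n, a n \in S) -> S = fullv :> {vspace E})
  (* the completed ring of integers O, its residue field and the coefficients in O *)
  (O : idomainType) (w : O) (iO : {rmorphism E -> {fraction O}})
  (O_compl : completed_integers p w iO)
  (F : fieldType) (red : {rmorphism O -> F}) (F_res : residue_field w red)
  (aO : nat -> O) (aO_a : forall n, iO (a n) = tofrac (aO n))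
  (* ordinarity and the unit root *)
  (ordinary : aO p \is a GRing.unit)
  (alpha : O) (alpha_unit : alpha \is a GRing.unit)
  (alpha_root : alpha ^+ 2 - aO p * alpha + p%:R = 0)
  (* the quaternion algebra, its Eichler order and the function h *)
  (B : falgType rat) (B_quat : quaternion_algebra B) (B_def : definite R B)
  (B_disc : has_discriminant B Nm)
  (S : set B) (S_eichler : eichler_p_order p Np S)
  (Zp : idomainType) (Zp_padic : padic_integers p Zp)
  (phi : {rmorphism B -> 'M[{fraction Zp}]_2}) (phi_split : splitting phi)
  (h : set (set 'cV[{fraction Zp}]_2) -> O)
  (h_JL : jacquet_langlands p (Np * Nm) S phi w aO h)
  (* the embedding of K, the vertices v_n and the groups Gt_n *)
  (Psi : {rmorphism K -> B})
  (Psi_opt : forall x, S (Psi x) <-> @p_integers p K x)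
  (v : nat -> set (set 'cV[{fraction Zp}]_2))
  (v_std : standard_vertices p (fun x => phi (Psi x)) v)
  (Gt : nat -> finGroupType) (q : forall n, 'M[{fraction Zp}]_2 -> Gt n)
  (Gt_q : forall n, is_Gtilde p (fun x => phi (Psi x)) n (q n))
  (* the anticyclotomic tower, its topological generator, the reciprocity map *)
  (Kn : nat -> set algC) (G : nat -> finGroupType)
  (res : forall n, {rmorphism algC -> algC} -> G n)
  (pr : forall n, G n.+1 -> G n)
  (tower : anticyclotomic_tower p iK Kn res pr)
  (gamma : {rmorphism algC -> algC}) (gamma_K : fixes_base iK gamma)
  (gamma_gen : forall n x, x \in <[res n gamma]>%g)
  (rec : forall n, 'M[{fraction Zp}]_2 -> G n)
  (rec_K : reciprocity_map p iK (fun x => phi (Psi x)) res pr rec)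
  (* p^s is the index in Gal(K_oo / K) of the image of U_1: the layer K_n is the
     one belonging to U_(n+1-s).  One has s = 0 if p does not divide h_K. *)
  (s : nat)
  (s_index : forall n g,
     (exists2 x, U p (fun x => phi (Psi x)) 1 x & rec n x = g) <->
     g \in <[res n gamma ^+ (p ^ s)]>%g)
  (* the p-adic L-function, as a power series *)
  (Lp : nat -> O) :
  let L n := theta_level (fun x => phi (Psi x)) (q (n.+1 - s)%N) (rec n)
               h (v (n.+1 - s)%N) in
  (forall n, (s <= n)%N ->
     series_at w (res n.+1 gamma) Lp
       (gmul (theta_stab alpha pr L n) (giota (theta_stab alpha pr L n)))) ->
  (exists j, Lp j != 0) ->
  mu_inv p w Lp = 0%E ->
  exists n0, forall n, (n0 <= n)%N ->
    mu_inv p w (L n) = 0%E /\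
    (2 * lambda_group p w red (L n))%N = lambda_series p w Lp.

Proof.
move=> L Lp_series _ mu0; have [w_dvr [z pz] _] := O_compl.
have [_ red0] := F_res.
(* The fraction field of [O] contains the number field [E], so it has characteristic 0. *)
have p0 : p%:R != 0 :> O.
  have : iO p%:R != 0 by rewrite -(rmorph_nat (in_alg E)) !fmorph_eq0 pnatr_eq0 -lt0n prime_gt0.
  by rewrite rmorph_nat -(rmorph_nat (@tofrac O)) tofrac_eq0.
have red_p : red p%:R = 0 by apply/red0; exists z.
apply: (@theta_family_invariants p O w F red G pr (fun n => res n gamma) alpha
  L Lp s) => //.
- exact: tower_pr_morph tower.
- by move=> n; apply: (tower_pr tower).
- exact: tower_card tower.
Qed.
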